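(* Let $K\ge 1$ and let $f=h+\overline{g}$ (with $h,g$ analytic in $\mathbb{D}$) be a $K$-quasiregular harmonic mapping defined on the unit disc $\mathbb{D}$ such that $f(0)=0$, $\lambda_f(0)=1$ and $\lambda_f(z)\le\lambda$ for all $z\in\mathbb{D}$, where $\lambda$ is a constant. Then $f$ is univalent on the disc $\mathbb{D}_{\rho_1}$ with $$\rho_1=\rho_1(\lambda)=\frac{1}{1+K\lambda},$$ and $f(\mathbb{D}_{\rho_1})$ contains a schlicht disc with radius $$R_1=\rho_1(\lambda)+K\lambda\left(\rho_1(\lambda)+\ln\left(K\lambda\,\rho_1(\lambda)\right)\right).$$
   Context: $\mathbb{D}=\{z\in\mathbb{C}:|z|<1\}$ and $\mathbb{D}_r=\{z\in\mathbb{C}:|z|<r\}$. Univalent means one-to-one. A schlicht disc in the image of a region under $f$ is an open disc that is the one-to-one image under $f$ of some subdomain of that region. A complex-valued function $f=u+iv$ is harmonic if $u$ and $v$ are real-valued harmonic functions. For a continuously differentiable $f$, put $\Lambda_f=|f_z|+|f_{\bar z}|$, $\lambda_f=\big||f_z|-|f_{\bar z}|\big|$, and $J_f=|f_z|^2-|f_{\bar z}|^2$ (the Jacobian). A harmonic function $f$ is sense-preserving if $J_f(z)>0$ in its domain. A sense-preserving harmonic mapping $f$ on $\mathbb{D}$ is $K$-quasiregular ($K\ge1$) if $\Lambda_f^2\le K J_f$, equivalently $\Lambda_f\le K\lambda_f$, everywhere on $\mathbb{D}$. *)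

(* Defs.v *)
(* Real and complex analysis over Stdlib's [R] and Coquelicot's [C]. *)
From Stdlib Require Export Reals.
From Coquelicot Require Export Coquelicot.

Open Scope R_scope.

Definition disc (w : C) (r : R) (z : C) : Prop := Cmod (z - w)%C < r.

Definition unit_disc : C -> Prop := disc (RtoC 0) 1.

Definition analytic_on (U : C -> Prop) (h : C -> C) : Prop :=
  forall z : C, U z -> ex_derive (K := C_AbsRing) (V := C_NormedModule) h z.

(* Partial derivatives with respect to [x] and [y] at [z = x + i y]; as usual
   for [Derive], they are meaningful only where the partials exist. *)
Definition pdx (u : C -> R) (z : C) : R := Derive (fun t : R => u (t, Im z)) (Re z).
Definition pdy (u : C -> R) (z : C) : R := Derive (fun t : R => u (Re z, t)) (Im z).

Definition C1_on (U : C -> Prop) (u : C -> R) : Prop :=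
  forall z : C, U z ->
    ex_derive (fun t : R => u (t, Im z)) (Re z) /\
    ex_derive (fun t : R => u (Re z, t)) (Im z) /\
    continuous (pdx u) z /\ continuous (pdy u) z.

Definition real_harmonic_on (U : C -> Prop) (u : C -> R) : Prop :=
  C1_on U u /\ C1_on U (pdx u) /\ C1_on U (pdy u) /\
  forall z : C, U z -> pdx (pdx u) z + pdy (pdy u) z = 0.

Definition harmonic_on (U : C -> Prop) (f : C -> C) : Prop :=
  real_harmonic_on U (fun z => Re (f z)) /\ real_harmonic_on U (fun z => Im (f z)).

Definition Cpdx (f : C -> C) (z : C) : C :=
  (pdx (fun w => Re (f w)) z, pdx (fun w => Im (f w)) z).
Definition Cpdy (f : C -> C) (z : C) : C :=
  (pdy (fun w => Re (f w)) z, pdy (fun w => Im (f w)) z).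

(* Wirtinger derivatives f_z = (f_x - i f_y)/2 and f_zbar = (f_x + i f_y)/2. *)
Definition d_z (f : C -> C) (z : C) : C := ((Cpdx f z - Ci * Cpdy f z) / 2)%C.
Definition d_zbar (f : C -> C) (z : C) : C := ((Cpdx f z + Ci * Cpdy f z) / 2)%C.

Definition Lambda_ (f : C -> C) (z : C) : R := Cmod (d_z f z) + Cmod (d_zbar f z).
Definition lambda_ (f : C -> C) (z : C) : R := Rabs (Cmod (d_z f z) - Cmod (d_zbar f z)).
Definition Jac (f : C -> C) (z : C) : R := Cmod (d_z f z) ^ 2 - Cmod (d_zbar f z) ^ 2.

Definition sense_preserving_on (U : C -> Prop) (f : C -> C) : Prop :=
  forall z : C, U z -> 0 < Jac f z.

Definition quasiregular_harmonic_on (U : C -> Prop) (K : R) (f : C -> C) : Prop :=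
  harmonic_on U f /\ sense_preserving_on U f /\
  forall z : C, U z -> Lambda_ f z ^ 2 <= K * Jac f z.

Definition univalent_on (U : C -> Prop) (f : C -> C) : Prop :=
  forall z1 z2 : C, U z1 -> U z2 -> f z1 = f z2 -> z1 = z2.

Definition connected_set (S : C -> Prop) : Prop :=
  forall A B : C -> Prop, open A -> open B ->
    (forall z, S z -> A z \/ B z) ->
    (exists z, S z /\ A z) -> (exists z, S z /\ B z) ->
    exists z, S z /\ A z /\ B z.

Definition domain (S : C -> Prop) : Prop :=
  open S /\ connected_set S /\ exists z, S z.

(* The disc of centre [w] and radius [r] is a schlicht disc in [f(U)].
   Nonemptiness of the subdomain [S] forces [0 < r]. *)
Definition schlicht_disc (f : C -> C) (U : C -> Prop) (w : C) (r : R) : Prop :=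
  exists S : C -> Prop,
    domain S /\ (forall z, S z -> U z) /\ univalent_on S f /\
    forall y : C, disc w r y <-> exists z, S z /\ f z = y.

(* Main.v *)
Require Import Defs.
From Stdlib Require Import Lra Psatz ClassicalEpsilon.

(* Write M = K lambda.  Since J_f = Lambda_f lambda_f, quasiregularity gives
   |h'| + |g'| <= M.  Cauchy's estimate on discs of radius 1 - |z|
   centred on [0, z], integrated along [0, z] and applied to a combination
   u h' + v g' with |u| = |v| = 1, yields
     |h'(z) - h'(0)| + |g'(z) - g'(0)| <= M |z| / (1 - |z|).
   Split f = A + e with A w = h'(0) w + conj (g'(0) w), so |A w| >= |w|.  The
   remainder e is M r / (1 - r)-Lipschitz on |z| <= r, a factor below 1
   exactly when r < 1 / (1 + M), and integrating along radii
   |e z| <= - M |z| - M ln (1 - |z|).  Hence f is injective on |z| < rho_1, and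
   the contraction z |-> A^-1 (y - e z) solves f z = y whenever |y| < R_1. *)

(** * Derivatives along real paths in the plane *)

(** Analyticity here means complex differentiability and nothing more. Continuity of h' and g' is
    therefore read off from the continuous partials of [f], since h' = f_z and g' is the conjugate
    of f_zbar. With a continuous derivative, Cauchy's estimate follows from differentiating a circle
    integral with respect to its radius. Both constants come from one function: r + M r + M ln (1 -
    r) has derivative 1 - M r / (1 - r), which vanishes exactly at rho_1. So R_1 is its maximum, and
    1 - rho_1 = M rho_1 produces the logarithm of the statement. The contraction degenerates at
    rho_1 itself, so the arguments run at radii r < rho_1 and approach rho_1 by continuity. A
    schlicht disc also requires a connected region above it; segments of the image disc are lifted
    to paths for that purpose. *)

(** Balls of [C_UniformSpace] are squares and those of [Cmod] are round; [sqrt 2] is the factor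
    between them. *)
Lemma locally_Cmod (z : C) (P : C -> Prop) :
  locally (T := C_UniformSpace) z P <->
  exists d : posreal, forall w : C, Cmod (w - z) < d -> P w.
Proof.
split.
- intros [d Hd]; exists d; intros w Hw; apply Hd.
  exact (C_NormedModule_mixin_compat1 z w d Hw).
- intros [d Hd].
  assert (Hd2 : 0 < d / sqrt 2)
    by (apply Rdiv_lt_0_compat; [apply cond_pos | apply sqrt_lt_R0; lra]).
  exists (mkposreal _ Hd2); intros w Hw; apply Hd.
  pose proof (C_NormedModule_mixin_compat2 z w (mkposreal _ Hd2) Hw) as H.
  simpl in H.
  replace (sqrt 2 * (d / sqrt 2)) with (pos d) in H; [exact H|].
  field. apply Rgt_not_eq, sqrt_lt_R0; lra.
Qed.

Lemma is_derive_C_approx (h : C -> C) (z l : C) (e : posreal) :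
  is_derive (K := C_AbsRing) (V := C_NormedModule) h z l ->
  locally (T := C_UniformSpace) z
    (fun w => Cmod (h w - h z - l * (w - z)) <= e * Cmod (w - z)).
Proof.
intros [_ H].
destruct (H z (fun P HP => HP) e) as [d Hd].
apply locally_Cmod. exists d; intros w Hw.
specialize (Hd w Hw).
rewrite (Cmult_comm l (w - z)).
exact Hd.
Qed.


(** Restriction of scalars from C to R, so that [h] can be composed with paths of a real parameter
    by the real chain rule. *)
Lemma is_derive_C_filterdiff (h : C -> C) (z l : C) :
  is_derive (K := C_AbsRing) (V := C_NormedModule) h z l ->
  filterdiff (K := R_AbsRing) (U := C_R_NormedModule) (V := C_R_NormedModule)
    h (locally z) (fun w => (l * w)%C).
Proof.
intros H; split.
- split.
  + intros x y; apply Cmult_plus_distr_l.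
  + intros k [x1 x2]; destruct l as [l1 l2].
    apply injective_projections; unfold scal; simpl; unfold scal; simpl;
      unfold mult; simpl; ring.
  + exists (Cmod l + 1); split; [generalize (Cmod_ge_0 l); lra|].
    intros x.
    change (norm ?y)
      with (norm (V := prod_NormedModule R_AbsRing R_NormedModule R_NormedModule) y).
    rewrite <- !Cmod_norm, Cmod_mult.
    generalize (Cmod_ge_0 x); nra.
- intros x Hx; apply (is_filter_lim_locally_unique (V := C_R_NormedModule)) in Hx.
  subst x; intros e.
  generalize (is_derive_C_approx h z l e H); apply filter_imp; intros w Hw.
  change (norm ?y)
    with (norm (V := prod_NormedModule R_AbsRing R_NormedModule R_NormedModule) y).
  rewrite <- !Cmod_norm; exact Hw.
Qed.

Definition path_derive (p : R -> C) (t : R) (l : C) : Prop :=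
  is_derive (K := R_AbsRing) (V := C_R_NormedModule) p t l.

Lemma path_derive_iff (p : R -> C) (t : R) (l : C) :
  path_derive p t l <->
  is_derive (fun s => Re (p s)) t (Re l) /\ is_derive (fun s => Im (p s)) t (Im l).
Proof.
split.
- intros H; split.
  + apply (filterdiff_ext_lin _ (fun y : R => Re (@scal R_AbsRing C_R_NormedModule y l)));
      [|reflexivity].
    apply (filterdiff_comp' (U := R_NormedModule) (V := C_R_NormedModule) p Re t
             (fun y : R => @scal R_AbsRing C_R_NormedModule y l) Re H).
    apply filterdiff_linear, is_linear_fst.
  + apply (filterdiff_ext_lin _ (fun y : R => Im (@scal R_AbsRing C_R_NormedModule y l)));
      [|reflexivity].
    apply (filterdiff_comp' (U := R_NormedModule) (V := C_R_NormedModule) p Im t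
             (fun y : R => @scal R_AbsRing C_R_NormedModule y l) Im H).
    apply filterdiff_linear, is_linear_snd.
- intros [H1 H2].
  unfold path_derive, is_derive.
  apply (filterdiff_ext (fun s => (Re (p s), Im (p s)))).
  { intros s; destruct (p s); reflexivity. }
  apply (filterdiff_ext_lin _ (fun y : R =>
    (@scal R_AbsRing R_NormedModule y (Re l), @scal R_AbsRing R_NormedModule y (Im l)))).
  2:{ intros y; destruct l; reflexivity. }
  apply (filterdiff_comp'_2 (T := R_NormedModule) (U := R_NormedModule)
     (V := R_NormedModule) (W := C_R_NormedModule)
     (fun s => Re (p s)) (fun s => Im (p s)) Datatypes.pair t _ _ Datatypes.pair H1 H2).
  apply (filterdiff_ext (fun u => u)); [intros [u v]; reflexivity|].
  apply (filterdiff_ext_lin _ (fun u => u)); [|intros [u v]; reflexivity].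
  apply filterdiff_id.
Qed.

Lemma path_derive_comp (h : C -> C) (p : R -> C) (t : R) (l m : C) :
  is_derive (K := C_AbsRing) (V := C_NormedModule) h (p t) l ->
  path_derive p t m -> path_derive (fun s => h (p s)) t (l * m)%C.
Proof.
intros Hh Hp.
unfold path_derive, is_derive.
apply (filterdiff_ext_lin _ (fun y : R => (l * @scal R_AbsRing C_R_NormedModule y m)%C)).
2:{ intros y; destruct l, m; apply injective_projections; unfold scal; simpl;
    unfold scal; simpl; unfold mult; simpl; ring. }
apply (filterdiff_comp' (U := R_NormedModule) (V := C_R_NormedModule)
  (W := C_R_NormedModule) p h t (fun y : R => @scal R_AbsRing C_R_NormedModule y m)
  (fun w => (l * w)%C) Hp).
now apply is_derive_C_filterdiff.
Qed.

Lemma path_derive_plus (p q : R -> C) (t : R) (l m : C) :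
  path_derive p t l -> path_derive q t m ->
  path_derive (fun s => (p s + q s)%C) t (l + m)%C.
Proof. exact (is_derive_plus (V := C_R_NormedModule) p q t l m). Qed.

Lemma path_derive_mult (p q : R -> C) (t : R) (l m : C) :
  path_derive p t l -> path_derive q t m ->
  path_derive (fun s => (p s * q s)%C) t (l * q t + p t * m)%C.
Proof.
intros Hp Hq; apply path_derive_iff in Hp; apply path_derive_iff in Hq.
destruct Hp as [p1 p2], Hq as [q1 q2].
apply path_derive_iff; split.
- evar_last.
  + apply (is_derive_minus (V := R_NormedModule) (fun s => Re (p s) * Re (q s))
      (fun s => Im (p s) * Im (q s))).
    * exact (is_derive_mult (K := R_AbsRing) (fun s => Re (p s))
        (fun s => Re (q s)) t _ _ p1 q1 Rmult_comm).
    * exact (is_derive_mult (K := R_AbsRing) (fun s => Im (p s))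
        (fun s => Im (q s)) t _ _ p2 q2 Rmult_comm).
  + unfold minus, plus, opp, mult, Re, Im; simpl; ring.
- evar_last.
  + apply (is_derive_plus (V := R_NormedModule) (fun s => Re (p s) * Im (q s))
      (fun s => Im (p s) * Re (q s))).
    * exact (is_derive_mult (K := R_AbsRing) (fun s => Re (p s))
        (fun s => Im (q s)) t _ _ p1 q2 Rmult_comm).
    * exact (is_derive_mult (K := R_AbsRing) (fun s => Im (p s))
        (fun s => Re (q s)) t _ _ p2 q1 Rmult_comm).
  + unfold minus, plus, opp, mult, Re, Im; simpl; ring.
Qed.

Lemma path_derive_const (c : C) (t : R) : path_derive (fun _ => c) t 0%C.
Proof. exact (is_derive_const (V := C_R_NormedModule) c t). Qed.

Lemma path_derive_scal (c : C) (p : R -> C) (t : R) (l : C) :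
  path_derive p t l -> path_derive (fun s => (c * p s)%C) t (c * l)%C.
Proof.
intros H; replace (c * l)%C with (0 * p t + c * l)%C by ring.
apply (path_derive_mult (fun _ => c)); [apply path_derive_const | exact H].
Qed.

Lemma path_derive_conj (p : R -> C) (t : R) (l : C) :
  path_derive p t l -> path_derive (fun s => Cconj (p s)) t (Cconj l).
Proof.
intros H; apply path_derive_iff in H; apply path_derive_iff.
split; [exact (proj1 H) | exact (is_derive_opp _ _ _ (proj2 H))].
Qed.

Lemma path_derive_line (a d : C) (t : R) :
  path_derive (fun s => (a + s * d)%C) t d.
Proof.
apply path_derive_iff; unfold Re, Im; split; simpl; auto_derive; trivial; ring.
Qed.

(** Turns a modulus into the real part of a rotated value, so that estimates for real-valued
    functions bound moduli. *)
Lemma unit_direction (w : C) : exists u : C, Cmod u = 1 /\ (u * w)%C = Cmod w.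
Proof.
destruct (Ceq_dec w 0) as [->|Hw].
- exists 1%C; rewrite Cmod_1, Cmod_0; split; [reflexivity | ring].
- exists (Cconj w / Cmod w)%C.
  assert (Hm : 0 < Cmod w) by now apply Cmod_gt_0.
  assert (Hm' : (RtoC (Cmod w)) <> 0%C) by (intros E; apply RtoC_inj in E; lra).
  split.
  + rewrite Cmod_div, Cmod_conj, Cmod_R, Rabs_pos_eq by (assumption || lra); field; lra.
  + replace (Cconj w / Cmod w * w)%C with (w * Cconj w / Cmod w)%C by (field; exact Hm').
    rewrite <- Cmod2_conj, RtoC_pow. field; exact Hm'.
Qed.

(** The mean value theorem fails for complex values. It is applied to [b t - Re (u * p t)], where
    [u] rotates the whole increment of [p] onto the nonnegative reals; the derivative of this real
    function is nonnegative. *)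
Lemma mean_value_majorant (p p' : R -> C) (b b' : R -> R) :
  (forall t, 0 <= t <= 1 -> path_derive p t (p' t)) ->
  (forall t, 0 <= t <= 1 -> is_derive b t (b' t)) ->
  (forall t, 0 <= t <= 1 -> Cmod (p' t) <= b' t) ->
  Cmod (p 1 - p 0) <= b 1 - b 0.
Proof.
intros Hp Hb Hle.
destruct (unit_direction (p 1 - p 0)) as [u [Hu Huw]].
pose (k t := b t - Re (u * p t)).
assert (Hk : forall t, 0 <= t <= 1 -> is_derive k t (b' t - Re (u * p' t))).
{ intros t Ht; apply (is_derive_minus (V := R_NormedModule)); [now apply Hb|].
  apply (path_derive_iff (fun s => (u * p s)%C)), path_derive_scal, Hp, Ht. }
destruct (MVT_gen k 0 1 (fun t => b' t - Re (u * p' t))) as [c [Hc E]];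
  rewrite ?Rmin_left, ?Rmax_right in * by lra.
- intros t Ht; apply Hk; lra.
- intros t Ht; apply continuity_pt_filterlim.
  apply (ex_derive_continuous (K := R_AbsRing) (V := R_NormedModule)).
  eexists; now apply Hk.
- assert (H : Re (u * p' c) <= b' c).
  { eapply Rle_trans; [apply Rle_abs|].
    eapply Rle_trans; [apply re_le_Cmod|].
    rewrite Cmod_mult, Hu, Rmult_1_l; now apply Hle. }
  assert (H1 : Cmod (p 1 - p 0) = Re (u * p 1) - Re (u * p 0)).
  { change (Cmod (p 1 - p 0)) with (Re (RtoC (Cmod (p 1 - p 0)))).
    rewrite <- Huw; simpl; ring. }
  unfold k in E; lra.
Qed.

(** * Cauchy's estimate at the centre of a disc *)

Lemma continuous_C_intro {U : UniformSpace} (p : U -> C) (x : U) :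
  continuous (fun y => Re (p y)) x -> continuous (fun y => Im (p y)) x ->
  continuous p x.
Proof.
intros H1 H2.
apply (continuous_ext (fun y => (Re (p y), Im (p y)))).
{ intros y; destruct (p y); reflexivity. }
apply (filterlim_filter_le_2 (G := filter_prod (locally (Re (p x))) (locally (Im (p x))))).
{ intros P [d Hd]; apply (Filter_prod _ _ _ (ball (Re (p x)) d) (ball (Im (p x)) d)).
  - exists d; trivial.
  - exists d; trivial.
  - intros u v Hu Hv; apply Hd; now split. }
apply filterlim_pair; [exact H1 | exact H2].
Qed.

Lemma continuous_Re (z : C) : continuous (T := C_UniformSpace) Re z.
Proof. exact (continuous_fst (fst z) (snd z)). Qed.
Lemma continuous_Im (z : C) : continuous (T := C_UniformSpace) Im z.
Proof. exact (continuous_snd (fst z) (snd z)). Qed.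

Lemma continuous_Cmod (z : C) : continuous (T := C_UniformSpace) Cmod z.
Proof.
apply filterlim_locally; intros e.
apply locally_Cmod; exists e; intros w Hw.
change (Rabs (Cmod w - Cmod z) < e).
apply Rabs_def1.
- generalize (Cmod_triangle (w - z) z).
  replace (w - z + z)%C with w by ring. lra.
- generalize (Cmod_triangle (z - w) w).
  replace (z - w + w)%C with z by ring.
  replace (z - w)%C with (- (w - z))%C by ring; rewrite Cmod_opp; lra.
Qed.

Lemma open_disc (c : C) (r : R) : open (disc c r).
Proof.
apply (open_comp (fun z : C => Cmod (z - c)) (fun x => x < r)).
- intros z _.
  apply (continuous_comp (fun z : C => (z - c)%C) Cmod); [|apply continuous_Cmod].
  apply (continuous_minus (V := C_R_NormedModule) (fun z => z) (fun _ => c)).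
  + apply continuous_id.
  + apply continuous_const.
- apply open_lt.
Qed.

Definition cis (t : R) : C := (cos t, sin t).

Lemma cis_conj (t : R) : (cis t * Cconj (cis t))%C = 1%C.
Proof.
rewrite <- (Cmod2_conj (cis t)), Cmod2_alt; simpl.
generalize (sin2_cos2 t); unfold Rsqr; intros E; f_equal; lra.
Qed.

Lemma Cmod_cis (t : R) : Cmod (cis t) = 1.
Proof.
unfold Cmod; simpl; rewrite !Rmult_1_r, Rplus_comm.
fold (Rsqr (sin t)) (Rsqr (cos t)); rewrite sin2_cos2; apply sqrt_1.
Qed.

Lemma path_derive_cis (t : R) : path_derive cis t (Ci * cis t)%C.
Proof.
apply path_derive_iff; unfold Re, Im; simpl; split; auto_derive; trivial; ring.
Qed.

Lemma continuous_cis (t : R) : continuous cis t.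
Proof.
apply (ex_derive_continuous (K := R_AbsRing) (V := C_R_NormedModule)).
exists (Ci * cis t)%C; apply path_derive_cis.
Qed.

Section CauchyEstimate.
Variables (G G' : C -> C) (c : C) (r : R).
Hypothesis HG : forall z, disc c r z ->
  is_derive (K := C_AbsRing) (V := C_NormedModule) G z (G' z).
Hypothesis HG' : forall z, disc c r z -> continuous G' z.

Let circ (s t : R) : C := (c + s * cis t)%C.
(** The integrand of Cauchy's formula for the first Taylor coefficient: its integral over a period
    is [2 * PI * s * G' c]. *)
Let k (s t : R) : C := (G (circ s t) * Cconj (cis t))%C.

Lemma disc_circ (s t : R) : Rabs s < r -> disc c r (circ s t).
Proof.
intros Hs; unfold disc, circ.
replace (c + s * cis t - c)%C with (s * cis t)%C by ring.
now rewrite Cmod_mult, Cmod_R, Cmod_cis, Rmult_1_r.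
Qed.

Lemma circle_integrand_derive_radius (s t : R) :
  Rabs s < r -> path_derive (fun x => k x t) s (G' (circ s t)).
Proof.
intros Hs; unfold k.
replace (G' (circ s t)) with (G' (circ s t) * cis t * Cconj (cis t) + G (circ s t) * 0)%C.
2:{ rewrite <- Cmult_assoc, cis_conj; ring. }
apply (path_derive_mult (fun x => G (circ x t)) (fun _ => Cconj (cis t)));
  [|apply path_derive_const].
apply (path_derive_comp G (fun x => circ x t)); [now apply HG, disc_circ|].
apply path_derive_line.
Qed.

(** The same [G' (circ s t)] occurs here and in the radial derivative, as in the polar
    Cauchy-Riemann equations. This link is the source of [circle_integral_parts]. *)
Lemma circle_integrand_derive_angle (s t : R) :
  Rabs s < r -> path_derive (k s) t (Ci * (s * G' (circ s t) - k s t))%C.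
Proof.
intros Hs; unfold k at 1.
replace (Ci * (s * G' (circ s t) - k s t))%C with
  (G' (circ s t) * (0 + s * (Ci * cis t)) * Cconj (cis t)
   + G (circ s t) * Cconj (Ci * cis t))%C.
2:{ unfold k; rewrite Cmult_conj.
    replace (Cconj Ci) with (- Ci)%C by (apply injective_projections; simpl; ring).
    transitivity (Ci * (s * G' (circ s t) * (cis t * Cconj (cis t))
      - G (circ s t) * Cconj (cis t)))%C;
     [ring | rewrite cis_conj; ring]. }
apply (path_derive_mult (fun x => G (circ s x)) (fun x => Cconj (cis x)));
  [|apply path_derive_conj, path_derive_cis].
apply (path_derive_comp G (circ s)); [now apply HG, disc_circ|].
apply path_derive_plus; [apply path_derive_const | apply path_derive_scal, path_derive_cis].
Qed.

Lemma circle_integrand_continuous (s t : R) : Rabs s < r -> continuous (fun x => Re (k s x)) t.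
Proof.
intros Hs; apply (ex_derive_continuous (K := R_AbsRing) (V := R_NormedModule)).
eexists; now apply (path_derive_iff (k s)), circle_integrand_derive_angle.
Qed.

Lemma circ_continuous (x : R * R) :
  continuous (T := prod_UniformSpace R_UniformSpace R_UniformSpace) (U := C_UniformSpace)
    (fun y => circ (fst y) (snd y)) x.
Proof.
assert (H1 : continuous (fun y : R * R => fst y) x) by (destruct x; apply continuous_fst).
assert (H2 : continuous (fun y : R * R => cis (snd y)) x).
{ apply (continuous_comp snd cis); [destruct x; apply continuous_snd | apply continuous_cis]. }
assert (H3 := continuous_comp _ Re _ H2 (continuous_Re _)).
assert (H4 := continuous_comp _ Im _ H2 (continuous_Im _)).
apply (continuous_plus (V := C_R_NormedModule) (fun _ => c)); [apply continuous_const|].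
apply (continuous_ext (fun y : R * R => (fst y * cos (snd y), fst y * sin (snd y)))).
{ intros y; apply injective_projections; simpl; ring. }
apply continuous_C_intro.
- now apply (continuous_mult (K := R_AbsRing) (fun y : R * R => fst y) (fun y => cos (snd y))).
- now apply (continuous_mult (K := R_AbsRing) (fun y : R * R => fst y) (fun y => sin (snd y))).
Qed.

Lemma derivative_circle_continuous (x : R * R) : Rabs (fst x) < r ->
  continuous (T := prod_UniformSpace R_UniformSpace R_UniformSpace)
    (fun y => Re (G' (circ (fst y) (snd y)))) x.
Proof.
intros Hx.
apply (continuous_comp (fun y : R * R => circ (fst y) (snd y)) (fun z => Re (G' z)));
  [apply circ_continuous|].
apply (continuous_comp G' Re); [now apply HG', disc_circ | apply continuous_Re].
Qed.

Lemma derivative_angle_continuous (s t : R) : Rabs s < r ->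
  continuous (fun x => Re (G' (circ s x))) t.
Proof.
intros Hs.
apply (continuous_comp_2 (fun _ : R => s) (fun x : R => x) (fun a b => Re (G' (circ a b)))).
- apply continuous_const.
- apply continuous_id.
- now apply (derivative_circle_continuous (s, t)).
Qed.

Lemma locally_Rabs_lt (s : R) : Rabs s < r -> locally s (fun x => Rabs x < r).
Proof.
intros Hs; apply (continuous_Rabs s (fun y => y < r)), open_lt; exact Hs.
Qed.

Let phi (s : R) : R := RInt (fun t => Re (k s t)) 0 (2 * PI).
Let psi (s : R) : R := RInt (fun t => Re (G' (circ s t))) 0 (2 * PI).

Lemma circle_integral_derive (s : R) : Rabs s < r -> is_derive phi s (psi s).
Proof.
intros Hs.
assert (HD : forall x t, Rabs x < r -> is_derive (fun y => Re (k y t)) x (Re (G' (circ x t)))).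
{ intros x t Hx; now apply (path_derive_iff (fun y => k y t)), circle_integrand_derive_radius. }
replace (psi s) with (RInt (fun t => Derive (fun u => Re (k u t)) s) 0 (2 * PI)).
2:{ apply RInt_ext; intros t _; now apply is_derive_unique, HD. }
apply (is_derive_RInt_param (fun s t => Re (k s t))).
- generalize (locally_Rabs_lt s Hs); apply filter_imp; intros x Hx t _.
  eexists; now apply HD.
- intros t _.
  apply continuity_2d_pt_ext_loc with (f := fun x y => Re (G' (circ x y))).
  + destruct (locally_Rabs_lt s Hs) as [d Hd]; exists d; intros x y Hx _.
    symmetry; apply is_derive_unique, HD, Hd; exact Hx.
  + apply continuity_2d_pt_filterlim; now apply (derivative_circle_continuous (s, t)).
- generalize (locally_Rabs_lt s Hs); apply filter_imp; intros x Hx.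
  apply (ex_RInt_continuous (V := R_CompleteNormedModule)).
    intros; now apply circle_integrand_continuous.
Qed.

(* The two sides differ by the integral of an angular derivative. *)
Lemma circle_integral_parts (s : R) : Rabs s < r -> phi s = s * psi s.
Proof.
intros Hs.
assert (I1 : is_RInt (fun t => Re (k s t)) 0 (2 * PI) (phi s)).
{ apply (RInt_correct (V := R_CompleteNormedModule)),
    (ex_RInt_continuous (V := R_CompleteNormedModule)).
  intros; now apply circle_integrand_continuous. }
assert (I2 : is_RInt (fun t => Re (G' (circ s t))) 0 (2 * PI) (psi s)).
{ apply (RInt_correct (V := R_CompleteNormedModule)),
    (ex_RInt_continuous (V := R_CompleteNormedModule)).
  intros; now apply derivative_angle_continuous. }
assert (I3 := is_RInt_minus _ _ _ _ _ _ (is_RInt_scal _ _ _ s _ I2) I1).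
(* The factor [Ci] of the angular derivative exchanges real and imaginary parts, so the
   antiderivative is [Im (k s t)]; by periodicity its increment is 0. *)
assert (I4 : is_RInt (fun t => minus (scal s (Re (G' (circ s t)))) (Re (k s t))) 0 (2 * PI)
  (minus (Im (k s (2 * PI))) (Im (k s 0)))).
{ apply (is_RInt_derive (V := R_CompleteNormedModule) (fun t => Im (k s t))).
  - intros t _.
    evar_last; [apply (path_derive_iff (k s)); now apply circle_integrand_derive_angle|].
    unfold minus, plus, opp, scal, Re, Im; simpl; unfold mult; simpl; ring.
  - intros t _; apply (continuous_minus (V := R_NormedModule)).
    + apply (continuous_scal_r (V := R_NormedModule)); now apply derivative_angle_continuous.
    + now apply circle_integrand_continuous. }
assert (E := eq_trans (eq_sym (is_RInt_unique (V := R_CompleteNormedModule) _ _ _ _ I3))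
  (is_RInt_unique (V := R_CompleteNormedModule) _ _ _ _ I4)).
assert (E2 : k s (2 * PI) = k s 0).
{ unfold k, circ; replace (cis (2 * PI)) with (cis 0); [reflexivity|].
  unfold cis; now rewrite cos_2PI, sin_2PI, cos_0, sin_0. }
rewrite E2 in E; unfold minus, plus, opp, scal in E; simpl in E; unfold mult in E; simpl in E.
lra.
Qed.

(* [phi' s = psi s] and [phi s = s psi s] make [phi s / s] constant, hence equal to
   its limit [phi' 0] at [0]. *)
Lemma circle_integral_linear (s : R) : 0 < s < r -> phi s = s * (2 * PI * Re (G' c)).
Proof.
intros Hs.
assert (P0 : phi 0 = 0) by (rewrite circle_integral_parts; [ring | rewrite Rabs_R0; lra]).
assert (HQ : forall x, 0 < x < s -> phi x / x = phi s / s).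
{ intros x Hx.
  apply (eq_is_derive (V := R_NormedModule) (fun y => phi y / y)); [|lra].
  intros t Ht.
  assert (Ht' : Rabs t < r) by (rewrite Rabs_pos_eq; lra).
  evar_last; [apply is_derive_div|].
  - now apply circle_integral_derive.
  - apply is_derive_id.
  - lra.
  - rewrite circle_integral_parts by exact Ht'; unfold one, zero; simpl; field; lra. }
assert (D0 : is_derive phi 0 (2 * PI * Re (G' c))).
{ replace (2 * PI * Re (G' c)) with (psi 0); [apply circle_integral_derive; rewrite Rabs_R0; lra|].
  unfold psi; rewrite (RInt_ext _ (fun _ => Re (G' c))).
  - rewrite RInt_const; unfold scal; simpl; unfold mult; simpl; ring.
  - intros t _; unfold circ; do 2 f_equal; ring. }
apply is_derive_Reals in D0.
assert (E : phi s / s = 2 * PI * Re (G' c)).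
{ apply cond_eq; intros e He; destruct (D0 e He) as [d Hd].
  assert (Hd0 := cond_pos d).
  pose (x := Rmin (d / 2) (s / 2)).
  assert (Hx : 0 < x) by (apply Rmin_glb_lt; lra).
  assert (Hx1 : x <= d / 2) by apply Rmin_l.
  assert (Hx2 : x <= s / 2) by apply Rmin_r.
  rewrite <- (HQ x) by lra.
  specialize (Hd x); rewrite Rplus_0_l, P0, Rminus_0_r in Hd; apply Hd; [lra|].
  rewrite Rabs_pos_eq; lra. }
rewrite <- E; field; lra.
Qed.

Lemma Re_derivative_le (M s : R) : 0 < s < r ->
  (forall z, disc c r z -> Cmod (G z) <= M) -> s * Re (G' c) <= M.
Proof.
intros Hs HM.
assert (Hs' : Rabs s < r) by (rewrite Rabs_pos_eq; lra).
assert (H : phi s <= 2 * PI * M).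
{ replace (2 * PI * M) with (RInt (fun _ => M) 0 (2 * PI)).
  2:{ rewrite RInt_const; unfold scal; simpl; unfold mult; simpl; ring. }
  apply RInt_le.
  - generalize PI_RGT_0; lra.
  - apply (ex_RInt_continuous (V := R_CompleteNormedModule)).
    intros; now apply circle_integrand_continuous.
  - apply ex_RInt_const.
  - intros t _.
    apply Rle_trans with (Cmod (k s t)).
    + eapply Rle_trans; [apply Rle_abs | apply re_le_Cmod].
    + unfold k; rewrite Cmod_mult, Cmod_conj, Cmod_cis, Rmult_1_r.
      now apply HM, disc_circ. }
rewrite circle_integral_linear in H by exact Hs.
generalize PI_RGT_0; nra.
Qed.

End CauchyEstimate.

(** * Growth of a bounded holomorphic function and of a bounded derivative *)

Lemma is_derive_C_scal (u : C) (G : C -> C) (z l : C) :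
  is_derive (K := C_AbsRing) (V := C_NormedModule) G z l ->
  is_derive (K := C_AbsRing) (V := C_NormedModule) (fun w => (u * G w)%C) z (u * l)%C.
Proof.
intros H; unfold is_derive.
apply (filterdiff_ext_lin (U := AbsRing_NormedModule C_AbsRing) (V := C_NormedModule)
  _ (fun y : C => (u * (y * l))%C)).
- exact (filterdiff_scal_r_fct (U := AbsRing_NormedModule C_AbsRing) (V := C_NormedModule)
    u G (fun y : C => (y * l)%C) Cmult_comm H).
- intros y; unfold scal; simpl; unfold mult; simpl; ring.
Qed.

Lemma is_derive_C_shift (G : C -> C) (d z l : C) :
  is_derive (K := C_AbsRing) (V := C_NormedModule) G (z + d)%C l ->
  is_derive (K := C_AbsRing) (V := C_NormedModule) (fun w => G (w + d)%C) z l.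
Proof.
intros H.
evar_last.
- apply (is_derive_comp (K := C_AbsRing) (V := C_NormedModule) G (fun w => (w + d)%C)); [exact H|].
  apply (is_derive_plus (K := C_AbsRing) (V := AbsRing_NormedModule C_AbsRing)
    (fun w => w) (fun _ => d)).
  + apply is_derive_id.
  + apply is_derive_const.
- unfold scal, plus, one, zero; simpl. unfold mult; simpl; ring.
Qed.

Lemma continuous_C_scal {U : UniformSpace} (u : C) (p : U -> C) (x : U) :
  continuous p x -> continuous (fun y => (u * p y)%C) x.
Proof.
intros H.
apply (continuous_ext (fun y => (p y * u)%C)); [intros y; apply Cmult_comm|].
apply (continuous_comp p (fun w => (w * u)%C)); [exact H|].
apply (filterdiff_continuous (K := R_AbsRing) (U := C_R_NormedModule) (V := C_R_NormedModule)).
eexists; apply is_derive_C_filterdiff.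
apply (is_derive_scal_l (K := C_AbsRing) (V := C_NormedModule) (fun w => w)).
apply is_derive_id.
Qed.

Lemma continuous_C_plus {U : UniformSpace} (p q : U -> C) (x : U) :
  continuous p x -> continuous q x -> continuous (fun y => (p y + q y)%C) x.
Proof. exact (continuous_plus (V := C_R_NormedModule) p q x). Qed.

Lemma cauchy_estimate (G G' : C -> C) (c : C) (r M : R) : 0 < r ->
  (forall z, disc c r z ->
     is_derive (K := C_AbsRing) (V := C_NormedModule) G z (G' z)) ->
  (forall z, disc c r z -> continuous G' z) ->
  (forall z, disc c r z -> Cmod (G z) <= M) ->
  r * Cmod (G' c) <= M.
Proof.
intros Hr HG HG' HM.
destruct (unit_direction (G' c)) as [u [Hu Huw]].
assert (H : forall s, 0 < s < r -> s * Cmod (G' c) <= M).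
{ intros s Hs.
  change (Cmod (G' c)) with (Re (RtoC (Cmod (G' c)))); rewrite <- Huw.
  apply (Re_derivative_le (fun z => (u * G z)%C) (fun z => (u * G' z)%C) c r); try exact Hs.
  - intros z Hz; now apply is_derive_C_scal, HG.
  - intros z Hz; now apply continuous_C_scal, HG'.
  - intros z Hz; rewrite Cmod_mult, Hu, Rmult_1_l; now apply HM. }
assert (Ha := Cmod_ge_0 (G' c)).
apply Rnot_lt_le; intros Hlt.
assert (H2 := H (r / 2) ltac:(lra)).
assert (Hpos : 0 < Cmod (G' c)) by nra.
(* Halfway between [r] and the radius at which [s * Cmod (G' c)] equals [M]: the estimate at this
   [s < r] is already contradictory. *)
pose (s := (M / Cmod (G' c) + r) / 2).
assert (E : M / Cmod (G' c) * Cmod (G' c) = M) by (field; lra).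
assert (H3 : M / Cmod (G' c) < r) by nra.
assert (H4 : 0 < M / Cmod (G' c)) by (apply Rdiv_lt_0_compat; nra).
specialize (H s ltac:(unfold s; lra)); unfold s in H; nra.
Qed.

Lemma disc_0_iff (r : R) (z : C) : disc (RtoC 0) r z <-> Cmod z < r.
Proof. unfold disc; replace (z - 0)%C with z by ring; reflexivity. Qed.

Lemma Cmod_segment (z1 z2 : C) (t r : R) :
  0 <= t <= 1 -> Cmod z1 <= r -> Cmod z2 <= r -> Cmod (z1 + t * (z2 - z1)) <= r.
Proof.
intros Ht H1 H2.
replace (z1 + t * (z2 - z1))%C with (RtoC (1 - t) * z1 + t * z2)%C by (rewrite RtoC_minus; ring).
eapply Rle_trans; [apply Cmod_triangle|].
rewrite !Cmod_mult, !Cmod_R, !Rabs_pos_eq by lra; nra.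
Qed.

Lemma mean_value_segment (F F' : C -> C) (a d : C) (L : R) :
  (forall t : R, 0 <= t <= 1 ->
     is_derive (K := C_AbsRing) (V := C_NormedModule) F (a + t * d)%C (F' (a + t * d)%C)) ->
  (forall t : R, 0 <= t <= 1 -> Cmod (F' (a + t * d)%C) <= L) ->
  Cmod (F (a + d)%C - F a) <= L * Cmod d.
Proof.
intros HF HL.
assert (H : Cmod (F (a + 1 * d)%C - F (a + 0 * d)%C) <= 1 * (L * Cmod d) - 0 * (L * Cmod d)).
{ apply (mean_value_majorant (fun t => F (a + t * d)%C) (fun t => (F' (a + t * d) * d)%C)
    (fun t => t * (L * Cmod d)) (fun _ => L * Cmod d)).
  - intros t Ht; apply path_derive_comp; [now apply HF | apply path_derive_line].
  - intros t _; auto_derive; trivial; ring.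
  - intros t Ht; rewrite Cmod_mult; apply Rmult_le_compat_r; [apply Cmod_ge_0 | now apply HL]. }
rewrite Cmult_1_l, Cmult_0_l, Cplus_0_r in H; lra.
Qed.

(** The radius is a parameter because difference quotients of step [d] are controlled only where
    [Cmod w < 1 - d]. *)
Lemma holomorphic_increment_le (G G' : C -> C) (r M : R) (z : C) :
  (forall z, Cmod z < r ->
     is_derive (K := C_AbsRing) (V := C_NormedModule) G z (G' z)) ->
  (forall z, Cmod z < r -> continuous G' z) ->
  (forall z, Cmod z < r -> Cmod (G z) <= M) ->
  Cmod z < r -> (r - Cmod z) * Cmod (G z - G 0) <= M * Cmod z.
Proof.
intros HG HG' HM Hz.
assert (Hz0 := Cmod_ge_0 z).
assert (Hseg : forall t, 0 <= t <= 1 -> Cmod (0 + t * z) <= Cmod z).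
{ intros t Ht; replace (0 + t * z)%C with (0 + t * (z - 0))%C by ring.
  apply Cmod_segment; rewrite ?Cmod_0; lra. }
assert (Hd : forall t, 0 <= t <= 1 -> (r - Cmod z) * Cmod (G' (0 + t * z)%C) <= M).
{ intros t Ht; specialize (Hseg t Ht).
  assert (Hsub : forall w, disc (0 + t * z)%C (r - Cmod z) w -> Cmod w < r).
  { intros w Hw; unfold disc in Hw.
    replace w with (w - (0 + t * z) + (0 + t * z))%C by ring.
    eapply Rle_lt_trans; [apply Cmod_triangle|]; lra. }
  apply (cauchy_estimate G); [lra | | |]; intros w Hw; [apply HG|apply HG'|apply HM]; auto. }
assert (E : (r - Cmod z) * (M / (r - Cmod z)) = M) by (field; lra).
assert (H' : Cmod (G z - G 0) <= M / (r - Cmod z) * Cmod z).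
{ replace z with (0 + z)%C at 1 by ring.
  apply (mean_value_segment G G').
  - intros t Ht; apply HG; specialize (Hseg t Ht); lra.
  - intros t Ht; specialize (Hd t Ht).
    apply Rmult_le_reg_l with (r - Cmod z); lra. }
replace (M * Cmod z) with ((r - Cmod z) * (M / (r - Cmod z) * Cmod z)) by (rewrite <- E at 2; ring).
apply Rmult_le_compat_l; lra.
Qed.

(* Applies [holomorphic_increment_le] to difference quotients of [F], so that
   no second derivative of [F] is needed. *)
Lemma derivative_increment_le (F F' : C -> C) (M : R) (z : C) :
  (forall z, Cmod z < 1 ->
     is_derive (K := C_AbsRing) (V := C_NormedModule) F z (F' z)) ->
  (forall z, Cmod z < 1 -> continuous F' z) ->
  (forall z, Cmod z < 1 -> Cmod (F' z) <= M) ->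
  Cmod z < 1 -> (1 - Cmod z) * Cmod (F' z - F' 0) <= M * Cmod z.
Proof.
intros HF HF' HM Hz.
assert (Hz0 := Cmod_ge_0 z).
set (X := Cmod (F' z - F' 0)).
assert (HX : 0 <= X) by apply Cmod_ge_0.
assert (quot : forall (w : C) (e : posreal), Cmod w < 1 -> exists d0, 0 < d0 /\
  forall d, 0 < d < d0 -> Cmod (/ d * (F (w + d) - F w) - F' w)%C <= e).
{ intros w e Hw.
  destruct (proj1 (locally_Cmod _ _) (is_derive_C_approx F w (F' w) e (HF w Hw))) as [d0 Hd0].
  exists d0; split; [apply cond_pos|]; intros d Hd.
  assert (Hdn : RtoC d <> 0%C) by (intros E; apply RtoC_inj in E; lra).
  specialize (Hd0 (w + d)%C).
  replace (w + d - w)%C with (RtoC d) in Hd0 by ring.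
  rewrite Cmod_R, Rabs_pos_eq in Hd0 by lra.
  specialize (Hd0 (proj2 Hd)).
  apply Rmult_le_reg_l with d; [lra|].
  replace (d * Cmod (/ d * (F (w + d) - F w) - F' w)%C)
    with (Cmod (F (w + d) - F w - F' w * d)%C); [lra|].
  transitivity (Cmod (d * (/ d * (F (w + d) - F w) - F' w))%C);
    [f_equal; field; exact Hdn|].
  now rewrite Cmod_mult, Cmod_R, Rabs_pos_eq by lra. }
apply le_epsilon; intros e He.
(* Error budget: replacing two derivatives by quotients costs at most [2 * k], and shrinking the
   radius by [d < k] costs at most [k * X]; together this is [e]. *)
pose (k := e / (X + 2)).
assert (Hk : 0 < k) by (apply Rdiv_lt_0_compat; lra).
assert (Ek : k * (X + 2) = e) by (unfold k; field; lra).
destruct (quot z (mkposreal k Hk) Hz) as [d1 [Hd1 H1]].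
destruct (quot 0%C (mkposreal k Hk)) as [d2 [Hd2 H2]]; [rewrite Cmod_0; lra|].
simpl in H1, H2.
pose (d := Rmin (Rmin d1 d2) (Rmin k (1 - Cmod z)) / 2).
assert (0 < d) by (apply Rdiv_lt_0_compat; [repeat apply Rmin_glb_lt; lra | lra]).
assert (d < d1 /\ d < d2 /\ d < k /\ d < 1 - Cmod z).
{ generalize (Rmin_l d1 d2) (Rmin_r d1 d2) (Rmin_l k (1 - Cmod z)) (Rmin_r k (1 - Cmod z))
    (Rmin_l (Rmin d1 d2) (Rmin k (1 - Cmod z))) (Rmin_r (Rmin d1 d2) (Rmin k (1 - Cmod z))).
  unfold d in *; lra. }
clearbody d.
specialize (H1 d ltac:(lra)); specialize (H2 d ltac:(lra)).
assert (Hdn : RtoC d <> 0%C) by (intros E; apply RtoC_inj in E; lra).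
assert (Hshift : forall w, Cmod w < 1 - d -> Cmod (w + d) < 1).
{ intros w Hw; eapply Rle_lt_trans; [apply Cmod_triangle|].
  rewrite Cmod_R, Rabs_pos_eq; lra. }
pose (D w := (/ d * (F (w + d) - F w))%C).
assert (HDr := holomorphic_increment_le D (fun w => (/ d * (F' (w + d) - F' w))%C) (1 - d) M z).
assert (HD : (1 - d - Cmod z) * Cmod (D z - D 0) <= M * Cmod z).
{ apply HDr; try lra; clear HDr.
  - intros w Hw; apply is_derive_C_scal.
    apply (is_derive_minus (K := C_AbsRing) (V := C_NormedModule) (fun w => F (w + d)%C) F).
    + apply is_derive_C_shift, HF, Hshift, Hw.
    + apply HF; lra.
  - intros w Hw; apply continuous_C_scal.
    apply (continuous_minus (V := C_R_NormedModule) (fun w => F' (w + d)%C) F').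
    + apply (continuous_comp (fun w : C => (w + d)%C) F'); [|apply HF', Hshift, Hw].
      apply continuous_C_plus; [apply continuous_id | apply continuous_const].
    + apply HF'; lra.
  (* The quotient inherits the bound [M] of [F'] through the mean value inequality on the segment
     from [w] to [w + d]. *)
  - intros w Hw; unfold D; rewrite Cmod_mult, Cmod_inv, Cmod_R, Rabs_pos_eq by (lra || exact Hdn).
    apply Rmult_le_reg_l with d; [lra|].
    rewrite <- Rmult_assoc, Rinv_r, Rmult_1_l by lra.
    assert (E : Cmod (F (w + d)%C - F w) <= M * Cmod d); [|rewrite Cmod_R, Rabs_pos_eq in E; lra].
    assert (Hin : forall t, 0 <= t <= 1 -> Cmod (w + t * d) < 1).
    { intros t Ht; eapply Rle_lt_trans; [apply Cmod_triangle|].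
      rewrite Cmod_mult, !Cmod_R, !Rabs_pos_eq by lra; nra. }
    apply (mean_value_segment F F'); intros t Ht; [apply HF | apply HM]; now apply Hin. }
assert (HXD : X <= Cmod (D z - D 0) + 2 * k).
{ unfold X.
  replace (F' z - F' 0)%C with ((D z - D 0) + (- (D z - F' z) + (D 0 - F' 0)))%C by ring.
  eapply Rle_trans; [apply Cmod_triangle|]; apply Rplus_le_compat_l.
  eapply Rle_trans; [apply Cmod_triangle|]; rewrite Cmod_opp.
  unfold D; lra. }
nra.
Qed.

(** * Wirtinger derivatives of a harmonic mapping *)

(** Translates hypotheses on the partials of [f] into hypotheses on h' and g'. The coordinate lines
    have velocities 1 and [Ci], which gives f_x = h' + conj g' and f_y = i h' + conj (i g'). *)
Lemma wirtinger_derivatives (f h g : C -> C) (z lh lg : C) :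
  locally z (fun w => f w = (h w + Cconj (g w))%C) ->
  is_derive (K := C_AbsRing) (V := C_NormedModule) h z lh ->
  is_derive (K := C_AbsRing) (V := C_NormedModule) g z lg ->
  d_z f z = lh /\ d_zbar f z = Cconj lg.
Proof.
intros Hf Hh Hg.
assert (P : forall (p : R -> C) (t : R) (m : C), p t = z -> path_derive p t m ->
  path_derive (fun s => f (p s)) t (lh * m + Cconj (lg * m))%C).
{ intros p t m Hpt Hp.
  apply (is_derive_ext_loc (V := C_R_NormedModule) (fun s => h (p s) + Cconj (g (p s)))%C).
  - assert (Hc : continuous (U := C_UniformSpace) p t).
    { apply (ex_derive_continuous (K := R_AbsRing) (V := C_R_NormedModule)); now exists m. }
    unfold continuous in Hc; rewrite Hpt in Hc.
    generalize (Hc _ Hf : locally t _); apply filter_imp; intros s E; now symmetry.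
  - rewrite <- Hpt in Hh, Hg.
    apply (path_derive_plus (fun s => h (p s)) (fun s => Cconj (g (p s))));
      [|apply path_derive_conj]; now apply path_derive_comp. }
assert (Ex : Cpdx f z = (lh + Cconj lg)%C).
{ assert (H := P (fun s => (s, Im z)) (Re z) 1%C).
  rewrite !Cmult_1_r in H.
  apply path_derive_iff in H.
  - destruct H as [H1 H2]; apply injective_projections;
      [exact (is_derive_unique _ _ _ H1) | exact (is_derive_unique _ _ _ H2)].
  - destruct z; reflexivity.
  - apply path_derive_iff; unfold Re, Im; simpl; split; auto_derive; trivial. }
assert (Ey : Cpdy f z = (lh * Ci + Cconj (lg * Ci))%C).
{ assert (H := P (fun s => (Re z, s)) (Im z) Ci).
  apply path_derive_iff in H.
  - destruct H as [H1 H2]; apply injective_projections;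
      [exact (is_derive_unique _ _ _ H1) | exact (is_derive_unique _ _ _ H2)].
  - destruct z; reflexivity.
  - apply path_derive_iff; unfold Re, Im; simpl; split; auto_derive; trivial. }
unfold d_z, d_zbar; rewrite Ex, Ey; destruct lh, lg.
split; apply injective_projections; simpl; field.
Qed.

(** Source of the continuity of h' and g' that Cauchy's estimate requires. *)
Lemma d_z_continuous (U : C -> Prop) (f : C -> C) (z : C) :
  harmonic_on U f -> U z -> continuous (d_z f) z /\ continuous (d_zbar f) z.
Proof.
intros [[H1 _] [H2 _]] Hz.
destruct (H1 z Hz) as (_ & _ & X1 & Y1), (H2 z Hz) as (_ & _ & X2 & Y2).
assert (HX : continuous (Cpdx f) z) by now apply continuous_C_intro.
assert (HY : continuous (Cpdy f) z) by now apply continuous_C_intro.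
split.
- assert (E : forall w : C, (/ 2 * (Cpdx f w + (- Ci) * Cpdy f w))%C = d_z f w).
  { intros w; unfold d_z; field. }
  apply (continuous_ext _ _ _ E).
  now apply continuous_C_scal, continuous_C_plus; [|apply continuous_C_scal].
- assert (E : forall w : C, (/ 2 * (Cpdx f w + Ci * Cpdy f w))%C = d_zbar f w).
  { intros w; unfold d_zbar; field. }
  apply (continuous_ext _ _ _ E).
  now apply continuous_C_scal, continuous_C_plus; [|apply continuous_C_scal].
Qed.

Lemma continuous_Cconj (z : C) : continuous (T := C_UniformSpace) (U := C_UniformSpace) Cconj z.
Proof.
apply continuous_C_intro.
- exact (continuous_Re z).
- apply (continuous_opp (V := R_NormedModule) Im), continuous_Im.
Qed.

(* Along a path in [S], the indicator of [A] would be a continuous function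
   with values 0 and 1 if [A] and [B] had no common point in [S]. *)
Lemma path_connected (S : C -> Prop) :
  (forall a b, S a -> S b -> exists k : R -> C,
     k 0 = a /\ k 1 = b /\ forall t, S (k t) /\ continuous k t) ->
  connected_set S.
Proof.
intros HS A B HA HB Hcov [a [Sa Aa]] [b [Sb Bb]].
apply NNPP; intros Hno.
destruct (HS a b Sa Sb) as (k & k0 & k1 & Hk).
pose (chi t := if excluded_middle_informative (A (k t)) then 0 else 1).
assert (Hchi : continuity chi).
{ intros t; apply continuity_pt_filterlim.
  destruct (Hk t) as [St Ct].
  destruct (excluded_middle_informative (A (k t))) as [At|NAt].
  - apply (continuous_ext_loc _ (fun _ => 0)); [|apply continuous_const].
    generalize (Ct A (HA _ At) : locally t _); apply filter_imp; intros s As.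
    unfold chi; destruct (excluded_middle_informative (A (k s))); tauto.
  - assert (Bt : B (k t)) by (destruct (Hcov _ St); tauto).
    apply (continuous_ext_loc _ (fun _ => 1)); [|apply continuous_const].
    generalize (Ct B (HB _ Bt) : locally t _); apply filter_imp; intros s Bs.
    unfold chi; destruct (excluded_middle_informative (A (k s))) as [As|]; [|reflexivity].
    exfalso; apply Hno; exists (k s); split; [apply Hk | tauto]. }
assert (chi0 : chi 0 = 0).
{ unfold chi; rewrite k0; destruct (excluded_middle_informative (A a)); tauto. }
assert (chi1 : chi 1 = 1).
{ unfold chi; rewrite k1; destruct (excluded_middle_informative (A b)); [|reflexivity].
  exfalso; apply Hno; exists b; tauto. }
destruct (IVT_gen chi 0 1 (1 / 2) Hchi) as [t [_ Ht]].
- rewrite chi0, chi1, Rmin_left, Rmax_right; lra.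
- unfold chi in Ht; destruct (excluded_middle_informative (A (k t))); lra.
Qed.

(** Banach's theorem on a closed disc. The increments of the iterates from 0 are dominated by a
    geometric series, and completeness is used one coordinate at a time. *)
Lemma contraction_fixpoint (T : C -> C) (r q : R) : 0 <= r -> 0 <= q < 1 ->
  (forall z, Cmod z <= r -> Cmod (T z) <= r) ->
  (forall z1 z2, Cmod z1 <= r -> Cmod z2 <= r -> Cmod (T z1 - T z2) <= q * Cmod (z1 - z2)) ->
  exists z, Cmod z <= r /\ T z = z.
Proof.
intros Hr Hq HT HL.
pose (x n := Nat.iter n T (RtoC 0)).
assert (Hx : forall n, Cmod (x n) <= r).
{ induction n; [unfold x; simpl; rewrite Cmod_0; exact Hr | now apply HT]. }
pose (D := Cmod (x 1%nat - x 0%nat)).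
assert (HD : forall n, Cmod (x (S n) - x n) <= D * q ^ n).
{ induction n; [unfold D; simpl; lra|].
  change (Cmod (T (x (S n)) - T (x n)) <= D * (q * q ^ n)).
  eapply Rle_trans; [apply HL; apply Hx|]; nra. }
(* [P] stands for [Re] and [Im]. The increments up to index [n] telescope to
   [P (x (S n)) - P (x 0)], hence the shift of the sequence below. *)
assert (Hcv : forall P : C -> R, (forall z w, P (z - w)%C = P z - P w) ->
   (forall z, Rabs (P z) <= Cmod z) -> exists l : R, is_lim_seq (fun n => P (x n)) l).
{ intros P Pm Pb.
  assert (Hs : ex_series (fun n => P (x (S n) - x n)%C)).
  { apply (ex_series_le (K := R_AbsRing) (V := R_CompleteNormedModule) _ (fun n => D * q ^ n)).
    - intros n; eapply Rle_trans; [apply Pb | apply HD].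
    - apply (ex_series_scal (K := R_AbsRing) (V := R_NormedModule) D (pow q)).
      apply ex_series_geom; rewrite Rabs_pos_eq; lra. }
  destruct Hs as [l Hl]; exists (l + P (x 0%nat)).
  apply is_lim_seq_incr_1.
  apply (is_lim_seq_ext (fun n => sum_n (fun n => P (x (S n) - x n)%C) n + P (x 0%nat))).
  - induction n; [rewrite sum_O, Pm; lra|].
    rewrite sum_Sn; unfold plus; simpl; simpl in IHn.
    rewrite Pm in *; lra.
  - apply is_lim_seq_plus'; [exact Hl | apply is_lim_seq_const]. }
destruct (Hcv Re) as [l1 H1]; [reflexivity | exact re_le_Cmod |].
destruct (Hcv Im) as [l2 H2]; [reflexivity | |].
{ intros z; eapply Rle_trans; [apply Rmax_r | apply Rmax_Cmod]. }
assert (Hl : forall e, 0 < e -> exists n,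
  Cmod (x n - (l1, l2)) < e /\ Cmod (x (S n) - (l1, l2)) < e).
{ intros e He.
  assert (He2 : 0 < e / 2) by lra.
  apply is_lim_seq_spec in H1; apply is_lim_seq_spec in H2.
  destruct (H1 (mkposreal _ He2)) as [N1 K1], (H2 (mkposreal _ He2)) as [N2 K2]; simpl in K1, K2.
  assert (HN : forall n, (N1 <= n)%nat -> (N2 <= n)%nat -> Cmod (x n - (l1, l2)) < e).
  { intros n Hn1 Hn2; specialize (K1 n Hn1); specialize (K2 n Hn2).
    replace (x n - (l1, l2))%C with (RtoC (Re (x n) - l1) + Ci * RtoC (Im (x n) - l2))%C
      by (apply injective_projections; unfold Re, Im; simpl; ring).
    eapply Rle_lt_trans; [apply Cmod_triangle|].
    rewrite Cmod_mult, Cmod_Ci, !Cmod_R; lra. }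
  exists (N1 + N2)%nat; split; apply HN; lia. }
exists (l1, l2).
assert (Hlr : Cmod (l1, l2) <= r).
{ apply le_epsilon; intros e He; destruct (Hl e He) as [n [Hn _]].
  replace (l1, l2) with (x n + - (x n - (l1, l2)))%C by ring.
  eapply Rle_trans; [apply Cmod_triangle|]; rewrite Cmod_opp; specialize (Hx n); lra. }
split; [exact Hlr|].
assert (E : Cmod (T (l1, l2) - (l1, l2)) <= 0).
{ apply le_epsilon; intros e He.
  destruct (Hl (e / 2)) as [n [Hn Hn']]; [lra|].
  replace (T (l1, l2) - (l1, l2))%C with
    (- (T (x n) - T (l1, l2)) + (x (S n) - (l1, l2)))%C by (simpl; ring).
  eapply Rle_trans; [apply Cmod_triangle|]; rewrite Cmod_opp.
  specialize (HL (x n) (l1, l2) (Hx n) Hlr).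
  generalize (Cmod_ge_0 (x n - (l1, l2))); nra. }
assert (E0 := Cmod_eq_0 _ (Rle_antisym _ _ E (Cmod_ge_0 _))).
replace (T (l1, l2)) with (T (l1, l2) - (l1, l2) + (l1, l2))%C by ring.
rewrite E0; ring.
Qed.

(** * Remainder of a harmonic mapping at the origin *)

(* The antiderivative of [M s / (1 - s)] vanishing at [0]. *)
Definition majorant (M s : R) : R := - M * s - M * ln (1 - s).

Lemma majorant_derive (M s : R) : s < 1 -> is_derive (majorant M) s (M * s / (1 - s)).
Proof. intros Hs; unfold majorant; auto_derive; [lra | field; lra]. Qed.

Lemma majorant_le (M r s : R) : 0 <= M -> 0 <= r <= s -> s < 1 -> majorant M r <= majorant M s.
Proof.
intros HM Hr Hs.
destruct (Req_dec r s) as [->|Hne]; [lra|].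
destruct (MVT_gen (majorant M) r s (fun x => M * x / (1 - x))) as [c [Hc E]];
  rewrite ?Rmin_left, ?Rmax_right in * by lra.
- intros x Hx; apply majorant_derive; lra.
- intros x Hx; apply continuity_pt_filterlim.
  apply (ex_derive_continuous (K := R_AbsRing) (V := R_NormedModule)).
  eexists; apply majorant_derive; lra.
- assert (0 <= M * c / (1 - c)) by (apply Rle_mult_inv_pos; nra).
  nra.
Qed.

Section HarmonicLandau.
Variables (f h g h' g' : C -> C) (M : R).
Hypothesis HM : 0 < M.
Hypothesis Hf : forall z, Cmod z < 1 -> f z = (h z + Cconj (g z))%C.
Hypothesis Hh : forall z, Cmod z < 1 ->
  is_derive (K := C_AbsRing) (V := C_NormedModule) h z (h' z).
Hypothesis Hg : forall z, Cmod z < 1 ->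
  is_derive (K := C_AbsRing) (V := C_NormedModule) g z (g' z).
Hypothesis Ch : forall z, Cmod z < 1 -> continuous h' z.
Hypothesis Cg : forall z, Cmod z < 1 -> continuous g' z.
Hypothesis Hbound : forall z, Cmod z < 1 -> Cmod (h' z) + Cmod (g' z) <= M.
Hypothesis Hf0 : f 0%C = 0%C.
Hypothesis Hlam : 1 <= Cmod (h' 0%C) - Cmod (g' 0%C).

Let rho : R := 1 / (1 + M).
Let A (w : C) : C := (h' 0 * w + Cconj (g' 0 * w))%C.
Let e (z : C) : C := (f z - A z)%C.

Lemma univalence_radius_bounds : 0 < rho < 1.
Proof.
unfold rho; split; [apply Rdiv_lt_0_compat; lra|].
apply Rmult_lt_reg_r with (1 + M); [lra|]; field_simplify; lra.
Qed.

Lemma contraction_factor (r : R) : 0 <= r < rho -> 0 <= M * r / (1 - r) < 1.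
Proof.
intros Hr; assert (Hrho := univalence_radius_bounds).
split; [apply Rle_mult_inv_pos; nra|].
apply Rmult_lt_reg_r with (1 - r); [lra|].
assert (E : rho * (1 + M) = 1) by (unfold rho; field; lra).
replace (M * r / (1 - r) * (1 - r)) with (M * r) by (field; lra); nra.
Qed.

(* Rotating [h] and [g] independently makes the two increments positive
   reals, so one holomorphic function controls both. *)
Lemma pair_increment_le (z : C) : Cmod z < 1 ->
  Cmod (h' z - h' 0) + Cmod (g' z - g' 0) <= M * Cmod z / (1 - Cmod z).
Proof.
intros Hz.
destruct (unit_direction (h' z - h' 0)) as [u [Hu Huw]].
destruct (unit_direction (g' z - g' 0)) as [v [Hv Hvw]].
assert (H : (1 - Cmod z) * Cmod ((u * h' z + v * g' z) - (u * h' 0 + v * g' 0))%C <= M * Cmod z).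
{ apply (derivative_increment_le (fun w => (u * h w + v * g w)%C)
    (fun w => (u * h' w + v * g' w)%C) M z); try exact Hz; intros w Hw.
  - apply (is_derive_plus (K := C_AbsRing) (V := C_NormedModule)
      (fun w => (u * h w)%C) (fun w => (v * g w)%C)); apply is_derive_C_scal; auto.
  - apply continuous_C_plus; apply continuous_C_scal; auto.
  - eapply Rle_trans; [apply Cmod_triangle|].
    rewrite !Cmod_mult, Hu, Hv, !Rmult_1_l; auto. }
replace ((u * h' z + v * g' z) - (u * h' 0 + v * g' 0))%C
  with (u * (h' z - h' 0) + v * (g' z - g' 0))%C in H by ring.
rewrite Huw, Hvw, <- RtoC_plus, Cmod_R, Rabs_pos_eq in H
  by (apply Rplus_le_le_0_compat; apply Cmod_ge_0).
apply Rmult_le_reg_l with (1 - Cmod z); [lra|].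
replace ((1 - Cmod z) * (M * Cmod z / (1 - Cmod z))) with (M * Cmod z) by (field; lra).
exact H.
Qed.

Lemma linear_part_plus (v w : C) : A (v + w)%C = (A v + A w)%C.
Proof. unfold A; rewrite !Cmult_plus_distr_l, Cplus_conj; ring. Qed.

Lemma linear_part_opp (w : C) : A (- w)%C = (- A w)%C.
Proof. apply injective_projections; unfold A; simpl; ring. Qed.

(** The least stretching of [A] is |h'(0)| - |g'(0)|, by the reverse triangle inequality, and [Hlam]
    bounds it below by 1. Inverting [A] therefore costs no constant. *)
Lemma linear_part_expands (w : C) : Cmod w <= Cmod (A w).
Proof.
assert (E : Cmod (h' 0 * w) <= Cmod (A w) + Cmod (g' 0 * w)).
{ rewrite <- (Cmod_conj (g' 0 * w)), <- (Cmod_opp (Cconj _)).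
  replace (h' 0 * w)%C with (A w + - Cconj (g' 0 * w))%C by (unfold A; ring).
  apply Cmod_triangle. }
rewrite !Cmod_mult in E; generalize (Cmod_ge_0 w); nra.
Qed.

Lemma linear_part_surjective (w : C) : exists v, A v = w.
Proof.
pose (D := Cmod (h' 0%C) ^ 2 - Cmod (g' 0%C) ^ 2).
assert (HD : D <> 0).
{ unfold D; generalize (Cmod_ge_0 (g' 0%C)); nra. }
(* Eliminating [Cconj v] between [A v = w] and its conjugate leaves [D * v]. *)
exists ((Cconj (h' 0%C) * w - Cconj (g' 0%C) * Cconj w) / D)%C.
revert HD; unfold D; rewrite !Cmod2_alt; unfold A.
destruct (h' 0%C) as [a b], (g' 0%C) as [c d], w as [x y]; unfold Re, Im; simpl; intros HD.
apply injective_projections; simpl; field; nra.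
Qed.

Lemma remainder_path_derive (a d : C) (t : R) : Cmod (a + t * d) < 1 ->
  path_derive (fun s => e (a + s * d)%C) t
    ((h' (a + t * d)%C - h' 0) * d + Cconj ((g' (a + t * d)%C - g' 0) * d))%C.
Proof.
intros Ht.
replace ((h' (a + t * d)%C - h' 0) * d + Cconj ((g' (a + t * d)%C - g' 0) * d))%C with
  (h' (a + t * d)%C * d + Cconj (g' (a + t * d)%C * d) + - (h' 0 * d + Cconj (g' 0 * d)))%C.
2:{ replace ((g' (a + t * d)%C - g' 0) * d)%C with (g' (a + t * d)%C * d - g' 0 * d)%C by ring.
    rewrite Cminus_conj; ring. }
assert (L := path_derive_line a d t).
apply path_derive_plus.
- apply (is_derive_ext_loc (V := C_R_NormedModule)
    (fun s => h (a + s * d) + Cconj (g (a + s * d)))%C).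
  + assert (Cl : continuous (U := C_UniformSpace) (fun s : R => (a + s * d)%C) t).
    { apply (ex_derive_continuous (K := R_AbsRing) (V := C_R_NormedModule)); now exists d. }
    (* The decomposition of [f] is known only inside the unit disc, where the path stays for
       parameters near [t]. *)
    assert (O := open_disc 0%C 1 _ (proj2 (disc_0_iff _ _) Ht)).
    generalize (Cl _ O : locally t _); apply filter_imp; intros s Hs.
    symmetry; apply Hf, disc_0_iff, Hs.
  + apply (path_derive_plus (fun s => h (a + s * d)%C)).
    * now apply (path_derive_comp h); [apply Hh|].
    * apply path_derive_conj; now apply (path_derive_comp g); [apply Hg|].
- apply (is_derive_opp (V := C_R_NormedModule) (fun s => A (a + s * d)%C)).
  apply (path_derive_plus (fun s => (h' 0 * (a + s * d))%C)).
  + now apply path_derive_scal.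
  + now apply path_derive_conj, path_derive_scal.
Qed.

Lemma remainder_derivative_le (z d : C) : Cmod z < 1 ->
  Cmod ((h' z - h' 0) * d + Cconj ((g' z - g' 0) * d)) <=
    M * Cmod z / (1 - Cmod z) * Cmod d.
Proof.
intros Hz; eapply Rle_trans; [apply Cmod_triangle|].
rewrite Cmod_conj, !Cmod_mult, <- Rmult_plus_distr_r.
apply Rmult_le_compat_r; [apply Cmod_ge_0 | now apply pair_increment_le].
Qed.

Lemma remainder_lipschitz (r : R) (z1 z2 : C) : r < 1 -> Cmod z1 <= r -> Cmod z2 <= r ->
  Cmod (e z2 - e z1) <= M * r / (1 - r) * Cmod (z2 - z1).
Proof.
intros Hr H1 H2.
set (L := M * r / (1 - r) * Cmod (z2 - z1)).
assert (H : Cmod (e (z1 + 1 * (z2 - z1)) - e (z1 + 0 * (z2 - z1)))%C <= 1 * L - 0 * L).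
{ apply (mean_value_majorant (fun t => e (z1 + t * (z2 - z1))%C) _ (fun t => t * L) (fun _ => L)
    (fun t Ht => remainder_path_derive z1 (z2 - z1) t
      (Rle_lt_trans _ _ _ (Cmod_segment z1 z2 t r Ht H1 H2) Hr))).
  - intros t _; auto_derive; trivial; ring.
  - intros t Ht; cbv beta.
    assert (Hz := Cmod_segment z1 z2 t r Ht H1 H2).
    assert (Hz0 := Cmod_ge_0 (z1 + t * (z2 - z1))).
    eapply Rle_trans; [apply remainder_derivative_le; lra|].
    apply Rmult_le_compat_r; [apply Cmod_ge_0|].
    apply Rmult_le_compat; [nra | apply Rlt_le, Rinv_0_lt_compat; lra | nra |].
    apply Rinv_le_contravar; lra. }
replace (z1 + 1 * (z2 - z1))%C with z2 in H by ring.
replace (z1 + 0 * (z2 - z1))%C with z1 in H by ring.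
lra.
Qed.

Lemma remainder_0 : e 0%C = 0%C.
Proof.
unfold e; rewrite Hf0; apply injective_projections; unfold A; simpl; ring.
Qed.

(** On a radius the derivative bound depends only on the distance to 0, so it is integrated exactly.
    This improves on [remainder_lipschitz], which uses the bound at the endpoint throughout, and it
    is where the logarithm arises. *)
Lemma remainder_le (z : C) : Cmod z < 1 -> Cmod (e z) <= majorant M (Cmod z).
Proof.
intros Hz; assert (Hz0 := Cmod_ge_0 z).
assert (Ht : forall t, 0 <= t <= 1 -> Cmod (0 + t * z) = t * Cmod z).
{ intros t Ht; rewrite Cplus_0_l, Cmod_mult, Cmod_R, Rabs_pos_eq; lra. }
assert (Ht1 : forall t, 0 <= t <= 1 -> Cmod (0 + t * z) < 1).
{ intros t Ht'; rewrite Ht by exact Ht'; nra. }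
assert (H : Cmod (e (0 + 1 * z) - e (0 + 0 * z))%C <=
  majorant M (1 * Cmod z) - majorant M (0 * Cmod z)).
{ apply (mean_value_majorant (fun t => e (0 + t * z)%C) _ (fun t => majorant M (t * Cmod z))
    (fun t => M * (t * Cmod z) / (1 - t * Cmod z) * Cmod z)
    (fun t Ht => remainder_path_derive 0 z t (Ht1 t Ht))).
  - intros t Ht'; evar_last.
    + apply (is_derive_comp (K := R_AbsRing) (V := R_NormedModule)
        (majorant M) (fun t => t * Cmod z)).
      * apply majorant_derive; rewrite <- (Ht t Ht'); auto.
      * auto_derive; trivial.
    + unfold scal; simpl; unfold mult; simpl; ring.
  - intros t Ht'; rewrite <- (Ht t Ht'); apply remainder_derivative_le; auto. }
replace (0 + 1 * z)%C with z in H by ring.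
replace (0 + 0 * z)%C with (RtoC 0) in H by ring.
rewrite remainder_0, Rmult_1_l, Rmult_0_l in H.
replace (e z - 0)%C with (e z) in H by ring.
replace (majorant M 0) with 0 in H
  by (unfold majorant; rewrite Rminus_0_r, ln_1; ring).
lra.
Qed.

(** A quantitative form of injectivity: it also makes the inverse of [f] Lipschitz, hence lifted
    paths continuous. *)
Lemma harmonic_expands (r : R) (z1 z2 : C) : r < 1 -> Cmod z1 <= r -> Cmod z2 <= r ->
  (1 - M * r / (1 - r)) * Cmod (z2 - z1) <= Cmod (f z2 - f z1).
Proof.
intros Hr H1 H2.
assert (HL := remainder_lipschitz r z1 z2 Hr H1 H2).
assert (HA := linear_part_expands (z2 - z1)).
assert (E : A (z2 - z1)%C = (f z2 - f z1 + - (e z2 - e z1))%C).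
{ unfold Cminus at 1; rewrite linear_part_plus, linear_part_opp; unfold e; ring. }
rewrite E in HA; assert (HT := Cmod_triangle (f z2 - f z1) (- (e z2 - e z1))).
rewrite Cmod_opp in HT; lra.
Qed.

(** * Univalence and the schlicht disc *)

Lemma harmonic_univalent : univalent_on (disc (RtoC 0) rho) f.
Proof.
intros z1 z2 H1 H2 E; apply -> disc_0_iff in H1; apply -> disc_0_iff in H2.
assert (Hrho := univalence_radius_bounds).
(* The expansion factor is 0 at [rho]; at the larger of the two moduli it is still positive. *)
pose (r := Rmax (Cmod z1) (Cmod z2)).
assert (Hr : 0 <= r < rho).
{ split; [eapply Rle_trans; [apply (Cmod_ge_0 z1) | apply Rmax_l] | now apply Rmax_lub_lt]. }
assert (H := harmonic_expands r z1 z2 ltac:(lra) (Rmax_l _ _) (Rmax_r _ _)).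
replace (f z2 - f z1)%C with (RtoC 0) in H by (rewrite E; ring).
rewrite Cmod_0 in H; assert (Hq := contraction_factor r Hr).
assert (Hd : Cmod (z2 - z1) = 0) by (generalize (Cmod_ge_0 (z2 - z1)); nra).
apply Cmod_eq_0 in Hd.
replace z1 with (z2 - (z2 - z1))%C by ring; rewrite Hd; ring.
Qed.

(* [f z = y] is the fixed point equation [z = A^-1 (y - e z)]. *)
Lemma harmonic_covers (r : R) (y : C) : 0 <= r < rho -> Cmod y + majorant M r <= r ->
  exists z, Cmod z <= r /\ f z = y.
Proof.
intros Hr Hy; assert (Hrho := univalence_radius_bounds).
(* A right inverse is enough: [linear_part_expands], applied to values and differences of values of
   [B], shows that [B] does not increase distances. *)
destruct (choice (fun w v => A v = w) linear_part_surjective) as [B HB].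
destruct (contraction_fixpoint (fun z => B (y - e z)%C) r (M * r / (1 - r))) as [z [Hz E]].
- lra.
- now apply contraction_factor.
- intros z Hz; eapply Rle_trans; [apply linear_part_expands|]; rewrite HB.
  eapply Rle_trans; [apply Cmod_triangle|]; rewrite Cmod_opp.
  assert (H1 := remainder_le z ltac:(lra)).
  assert (H2 := majorant_le M (Cmod z) r ltac:(lra) (conj (Cmod_ge_0 z) Hz) ltac:(lra)).
  lra.
- intros z1 z2 H1 H2; eapply Rle_trans; [apply linear_part_expands|].
  unfold Cminus at 1; rewrite linear_part_plus, linear_part_opp, !HB.
  replace (y - e z1 + - (y - e z2))%C with (- (e z1 - e z2))%C by ring.
  rewrite Cmod_opp; apply remainder_lipschitz; lra.
- exists z; split; [exact Hz|].
  apply (f_equal A) in E; rewrite HB in E; unfold e in E.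
  replace (f z) with (A z - (y - (f z - A z)) + y)%C by ring.
  rewrite E at 1. ring.
Qed.

Let R1 : R := rho - majorant M rho.

(** As [rho * (1 + M) = 1], the radius equals 1 - M ln (1 + 1/M), and ln (1 + x) < x for x > 0.
    Positivity puts 0 into the region above the disc. *)
Lemma covering_radius_pos : 0 < R1.
Proof.
assert (Hrho := univalence_radius_bounds).
assert (E : rho * (1 + M) = 1) by (unfold rho; field; lra).
assert (Hln : - ln (1 - rho) < / M).
{ rewrite <- ln_Rinv by lra.
  replace (/ (1 - rho)) with (1 + / M).
  2:{ replace (1 - rho) with (M * rho) by lra.
      unfold rho; field; lra. }
  apply Rlt_le_trans with (ln (exp (/ M))); [|rewrite ln_exp; lra].
  apply ln_increasing; [generalize (Rinv_0_lt_compat M HM); lra|].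
  apply exp_ineq1, Rgt_not_eq, Rinv_0_lt_compat, HM. }
assert (E2 : M * / M = 1) by (field; lra).
unfold R1, majorant; nra.
Qed.

(** [harmonic_covers] needs [r < rho] strictly; continuity of [s - majorant M s] at [rho] leaves
    room for every [m] below [R1]. *)
Lemma covering_radius_approx (m : R) : m < R1 -> exists r, 0 <= r < rho /\ m + majorant M r <= r.
Proof.
intros Hm; assert (Hrho := univalence_radius_bounds).
assert (Cc : continuous (fun s => s - majorant M s) rho).
{ apply (ex_derive_continuous (K := R_AbsRing) (V := R_NormedModule)).
  apply (ex_derive_minus (V := R_NormedModule) (fun s => s) (majorant M)).
  - apply ex_derive_id.
  - eexists; apply majorant_derive; lra. }
destruct (Cc _ (open_gt m _ Hm)) as [d Hd].
assert (Hd0 := cond_pos d).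
pose (x := Rmin (d / 2) (rho / 2)).
assert (0 < x) by (apply Rmin_glb_lt; lra).
assert (x <= d / 2) by apply Rmin_l.
assert (x <= rho / 2) by apply Rmin_r.
exists (rho - x); split; [lra|].
assert (H2 : m < rho - x - majorant M (rho - x)); [|lra].
apply Hd; change (Rabs (rho - x - rho) < d).
rewrite Rabs_left; lra.
Qed.

Lemma harmonic_continuous (z : C) : Cmod z < 1 ->
  continuous (T := C_UniformSpace) (U := C_UniformSpace) f z.
Proof.
intros Hz.
apply (continuous_ext_loc _ (fun w => h w + Cconj (g w))%C).
- generalize (open_disc 0%C 1 _ (proj2 (disc_0_iff _ _) Hz)); apply filter_imp.
  intros w Hw; symmetry; apply Hf, disc_0_iff, Hw.
- assert (K : forall k l, is_derive (K := C_AbsRing) (V := C_NormedModule) k z l ->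
    continuous (T := C_UniformSpace) (U := C_UniformSpace) k z).
  { intros k l H.
    apply (filterdiff_continuous (K := R_AbsRing) (U := C_R_NormedModule) (V := C_R_NormedModule)).
    eexists; exact (is_derive_C_filterdiff _ _ _ H). }
  apply continuous_C_plus; [exact (K _ _ (Hh z Hz))|].
  apply (continuous_comp g Cconj); [exact (K _ _ (Hg z Hz)) | apply continuous_Cconj].
Qed.

(** The region is the part of the [rho]-disc that [f] sends into the [R1]-disc. Its connectedness is
    the delicate point: the segment from [f a] to [f b] is lifted through the inverse of [f]. *)
Lemma harmonic_schlicht : schlicht_disc f (disc (RtoC 0) rho) 0%C R1.
Proof.
assert (Hrho := univalence_radius_bounds).
exists (fun z => disc (RtoC 0) rho z /\ disc (RtoC 0) R1 (f z)).
split; [split; [|split]|split; [|split]].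
- intros z [Hz Hfz].
  apply filter_and; [exact (open_disc _ _ _ Hz)|].
  apply -> disc_0_iff in Hz.
  apply (harmonic_continuous z ltac:(lra) _ (open_disc _ _ _ Hfz)).
- apply path_connected; intros a b [Ha Hfa] [Hb Hfb].
  assert (Hfa' := proj1 (disc_0_iff _ _) Hfa); assert (Hfb' := proj1 (disc_0_iff _ _) Hfb).
  (* A single [r < rho] for the whole segment gives the lift a uniform Lipschitz constant. *)
  destruct (covering_radius_approx (Rmax (Cmod (f a)) (Cmod (f b)))) as [r [Hr Hm]];
    [now apply Rmax_lub_lt|].
  (* [path_connected] asks for a path on all of R, so the parameter is clamped to [0, 1]. *)
  pose (cl t := Rmax 0 (Rmin 1 t)).
  assert (Hcl : forall t, 0 <= cl t <= 1).
  { intros t; split; [apply Rmax_l | apply Rmax_lub; [lra | apply Rmin_l]]. }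
  pose (y t := (f a + cl t * (f b - f a))%C).
  assert (Hy : forall t, Cmod (y t) <= Rmax (Cmod (f a)) (Cmod (f b))).
  { intros t; apply Cmod_segment; [apply Hcl | apply Rmax_l | apply Rmax_r]. }
  destruct (choice (fun t z => Cmod z <= r /\ f z = y t)) as [k Hk].
  { intros t; apply harmonic_covers; [exact Hr|]; specialize (Hy t); lra. }
  assert (Sk : forall t, disc (RtoC 0) rho (k t)).
  { intros t; apply disc_0_iff; destruct (Hk t); lra. }
  exists k; split; [|split].
  (* The lift is made of arbitrary preimages; univalence forces its endpoints to be [a] and [b]. *)
  + apply harmonic_univalent; [apply Sk | exact Ha |].
    rewrite (proj2 (Hk 0)); unfold y, cl; rewrite Rmin_right, Rmax_left by lra; ring.
  + apply harmonic_univalent; [apply Sk | exact Hb |].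
    rewrite (proj2 (Hk 1)); unfold y, cl; rewrite Rmin_right, Rmax_right by lra; ring.
  + intros t; split; [split; [apply Sk|]|].
    * apply disc_0_iff; rewrite (proj2 (Hk t)).
      eapply Rle_lt_trans; [apply Hy | now apply Rmax_lub_lt].
    * assert (Hq := contraction_factor r Hr); set (q := M * r / (1 - r)) in *.
      assert (Lip : forall s, (1 - q) * Cmod (k s - k t) <= Rabs (s - t) * Cmod (f b - f a)).
      { intros s.
        eapply Rle_trans; [apply harmonic_expands; [lra | apply Hk | apply Hk]|].
        rewrite (proj2 (Hk s)), (proj2 (Hk t)).
        replace (y s - y t)%C with (RtoC (cl s - cl t) * (f b - f a))%C
          by (unfold y; rewrite RtoC_minus; ring).
        rewrite Cmod_mult, Cmod_R; apply Rmult_le_compat_r; [apply Cmod_ge_0|].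
        unfold cl, Rmax, Rmin, Rabs;
          repeat (destruct Rle_dec || destruct Rcase_abs); lra. }
      intros P HP; apply locally_Cmod in HP; destruct HP as [d Hd].
      assert (Hd0 := cond_pos d); assert (HF := Cmod_ge_0 (f b - f a)).
      (* The summand 1 keeps the denominator positive when [f a = f b]. *)
      assert (Hd' : 0 < (1 - q) * d / (Cmod (f b - f a) + 1)).
      { apply Rdiv_lt_0_compat; [apply Rmult_lt_0_compat|]; lra. }
      exists (mkposreal _ Hd'); intros s Hs; apply Hd.
      change (Rabs (s - t) < (1 - q) * d / (Cmod (f b - f a) + 1)) in Hs.
      apply Rmult_lt_reg_l with (1 - q); [lra|].
      eapply Rle_lt_trans; [apply Lip|].
      apply Rmult_lt_compat_r with (r := Cmod (f b - f a) + 1) in Hs; [|lra].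
      replace ((1 - q) * d / (Cmod (f b - f a) + 1) * (Cmod (f b - f a) + 1))
        with ((1 - q) * d) in Hs by (field; lra).
      generalize (Rabs_pos (s - t)); nra.
- exists 0%C; rewrite Hf0; split; apply disc_0_iff; rewrite Cmod_0;
    [lra | apply covering_radius_pos].
- intros z Hz; apply Hz.
- intros z1 z2 [H1 _] [H2 _]; now apply harmonic_univalent.
- intros y; split.
  + intros Hy.
    destruct (covering_radius_approx (Cmod y)) as [r [Hr Hm]]; [now apply disc_0_iff|].
    destruct (harmonic_covers r y Hr Hm) as [z [Hz E]].
    exists z; rewrite E; split; [split; [apply disc_0_iff; lra | exact Hy] | reflexivity].
  + intros [z [[_ Hz] <-]]; exact Hz.
Qed.

End HarmonicLandau.

(** * From quasiregularity to bounds on h' and g' *)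

Theorem corollary2p6 (K lam : R) (f h g : C -> C)
  (hK : 1 <= K)
  (hh : analytic_on unit_disc h) (hg : analytic_on unit_disc g)
  (hf : forall z : C, unit_disc z -> f z = (h z + Cconj (g z))%C)
  (hqr : quasiregular_harmonic_on unit_disc K f)
  (hf0 : f (RtoC 0) = RtoC 0)
  (hlam0 : lambda_ f (RtoC 0) = 1)
  (hlam : forall z : C, unit_disc z -> lambda_ f z <= lam) :
  let rho1 := 1 / (1 + K * lam) in
  let R1 := rho1 + K * lam * (rho1 + ln (K * lam * rho1)) in
  univalent_on (disc (RtoC 0) rho1) f /\
  exists w : C, schlicht_disc f (disc (RtoC 0) rho1) w R1.
Proof.
intros rho1 R1.
destruct hqr as [harm [hsp hLam]].
assert (Hud : forall z, Cmod z < 1 -> unit_disc z) by (intros z; apply disc_0_iff).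
assert (Hlam1 : 1 <= lam).
{ rewrite <- hlam0; apply hlam, Hud; rewrite Cmod_0; lra. }
assert (HM : 0 < K * lam) by nra.
pose (g' z := Cconj (d_zbar f z)).
assert (Hd : forall z, Cmod z < 1 ->
  is_derive (K := C_AbsRing) (V := C_NormedModule) h z (d_z f z) /\
  is_derive (K := C_AbsRing) (V := C_NormedModule) g z (g' z)).
{ intros z Hz; destruct (hh z (Hud z Hz)) as [lh Hlh], (hg z (Hud z Hz)) as [lg Hlg].
  destruct (wirtinger_derivatives f h g z lh lg) as [E1 E2]; try assumption.
  - generalize (open_disc _ _ _ (Hud z Hz)); apply filter_imp; exact hf.
  - unfold g'; rewrite E1, E2, Cconj_conj; now split. }
assert (Hpos : forall z, Cmod z < 1 -> Cmod (d_zbar f z) < Cmod (d_z f z)).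
{ intros z Hz; generalize (hsp z (Hud z Hz)); unfold Jac.
  generalize (Cmod_ge_0 (d_z f z)) (Cmod_ge_0 (d_zbar f z)); nra. }
assert (Hbound : forall z, Cmod z < 1 -> Cmod (d_z f z) + Cmod (g' z) <= K * lam).
{ intros z Hz; unfold g'; rewrite Cmod_conj.
  generalize (hLam z (Hud z Hz)) (hlam z (Hud z Hz)) (Hpos z Hz) (Cmod_ge_0 (d_zbar f z)).
  unfold Lambda_, lambda_, Jac; intros H1 H2 H3 H4.
  rewrite Rabs_pos_eq in H2 by lra.
  (* Once [Jac] is factored, a factor |f_z| + |f_zbar| cancels; it is positive by [Hpos]. *)
  apply Rle_trans with (K * (Cmod (d_z f z) - Cmod (d_zbar f z))); [|nra].
  apply Rmult_le_reg_l with (Cmod (d_z f z) + Cmod (d_zbar f z)); [lra|]; nra. }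
assert (Hlow : 1 <= Cmod (d_z f 0) - Cmod (g' 0%C)).
{ assert (H0 : Cmod (RtoC 0) < 1) by (rewrite Cmod_0; lra).
  unfold g'; rewrite Cmod_conj; generalize (Hpos _ H0); unfold lambda_ in hlam0.
  intros H; rewrite Rabs_pos_eq in hlam0 by lra; lra. }
assert (Cc : forall z, Cmod z < 1 -> continuous (d_z f) z /\ continuous g' z).
{ intros z Hz; destruct (d_z_continuous _ f z harm (Hud z Hz)) as [C1 C2].
  split; [exact C1|].
  apply (continuous_comp (d_zbar f) Cconj); [exact C2 | apply continuous_Cconj]. }
(* The logarithms agree because [1 - rho1 = K * lam * rho1]. *)
assert (ER : R1 = rho1 - majorant (K * lam) rho1).
{ unfold R1, majorant; replace (1 - rho1) with (K * lam * rho1); [ring|].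
  unfold rho1; field; lra. }
assert (Hh := fun z Hz => proj1 (Hd z Hz)); assert (Hg := fun z Hz => proj2 (Hd z Hz)).
assert (Ch := fun z Hz => proj1 (Cc z Hz)); assert (Cg := fun z Hz => proj2 (Cc z Hz)).
assert (hf' := fun z Hz => hf z (Hud z Hz)).
split.
- exact (harmonic_univalent f h g (d_z f) g' (K * lam) HM hf' Hh Hg Ch Cg Hbound Hlow).
- exists 0%C; rewrite ER.
  exact (harmonic_schlicht f h g (d_z f) g' (K * lam) HM hf' Hh Hg Ch Cg Hbound hf0 Hlow).
Qed.
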